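(* Let $p$ be a prime and let $\mathbb K$ be a subfield of the algebraic closure $\overline{\mathbb F}_p$ of $\mathbb F_p$. For a formal power series $A\in\mathfrak m=X\mathbb K[[X]]$, the following are equivalent: (i) $A$ is rational; (ii) $\exp_!(A)$ is rational.
   Context: A power series in $\mathbb K[[X]]$ is rational if it equals $f/g$ for polynomials $f,g\in\mathbb K[X]$ with $g(0)\neq 0$. The map $\exp_!:\mathfrak m\to 1+\mathfrak m$ is defined as follows: for $A=\sum_{n\ge1}\alpha_nX^n$, write $\exp\left(\sum_{n\ge 1}\alpha_n\frac{X^n}{n!}\right)=1+\sum_{n\ge1}\beta_n\frac{X^n}{n!}$ and set $\exp_!(A)=1+\sum_{n\ge1}\beta_nX^n$. Here the $\beta_n$ are well defined over any field: each $\beta_n$ is given by a universal polynomial with nonnegative integer coefficients in $\alpha_1,\dots,\alpha_n$ (the expressions $\frac1{k!}a^k$ for $a$ an exponential generating series without constant term have integer-polynomial coefficients in this sense), so the formal identity over $\mathbb Z$ is reduced to $\mathbb K$. *)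

(* Defs.v *)
From HB Require Import structures.
From mathcomp Require Import all_boot all_order all_algebra.
From mathcomp Require Import mpoly ring.
Set Implicit Arguments.
Unset Strict Implicit.
Unset Printing Implicit Defensive.
Import Order.TTheory GRing.Theory Num.Theory.
Local Open Scope ring_scope.

(* A formal power series over R is its sequence of coefficients. *)
Definition fps (R : Type) := nat -> R.

Definition fps_mul (R : nzRingType) (A B : fps R) : fps R :=
  fun n => \sum_(i < n.+1) A i * B (n - i)%N.

Definition fps_of_poly (R : nzRingType) (f : {poly R}) : fps R :=
  fun n => f`_n.

(* A = f / g, written A * g = f: a polynomial g with g(0) != 0 is invertible
   as a power series. *)
Definition rational_fps (K : fieldType) (A : fps K) : Prop :=
  exists f g : {poly K},
    g.[0] != 0 /\ fps_mul A (fps_of_poly g) =1 fps_of_poly f.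

(* \sum_(1 <= k <= n) alpha_k X^k / k!, the generic exponential generating
   series modulo X^(n+1); the indeterminate alpha_k is 'X_(k-1). *)
Definition generic_egs n : {poly {mpoly rat[n]}} :=
  \sum_(i < n) ((i.+1)`!%:R^-1 *: 'X_i) *: 'X^(i.+1).

(* beta_n = n! [X^n] exp(\sum_k alpha_k X^k / k!). The terms alpha_k with
   k > n and the powers a^k / k! with k > n do not contribute to the
   coefficient of X^n, since a has no constant term. *)
Definition beta_rat n : {mpoly rat[n]} :=
  n`!%:R *: \sum_(k < n.+1) (k`!%:R^-1 : rat) *: (generic_egs n ^+ k)`_n.

(* The same polynomial with coefficients in int (see beta_intE below):
   numq maps a rational number which is an integer to this integer. *)
Definition beta_int n : {mpoly int[n]} := map_mpoly numq (beta_rat n).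

Definition exp_bang (K : fieldType) (A : fps K) : fps K :=
  fun n => mmap (fun z : int => z%:~R) (fun i : 'I_n => A i.+1) (beta_int n).

Definition nat_coefs n (p : {mpoly rat[n]}) : Prop :=
  forall m, p@_m \is a Num.nat.

Lemma nat_coefsM n (p q : {mpoly rat[n]}) :
  nat_coefs p -> nat_coefs q -> nat_coefs (p * q).
Proof.
by move=> pP qP m; rewrite mcoeffM; apply: rpred_sum => i _; apply: rpredM.
Qed.

Lemma nat_coefs_sum n (I : Type) (r : seq I) (F : I -> {mpoly rat[n]}) :
  (forall i, nat_coefs (F i)) -> nat_coefs (\sum_(i <- r) F i).
Proof.
by move=> FP m; rewrite raddf_sum; apply: rpred_sum => i _; apply: FP.
Qed.

Lemma fact_rat_neq0 q : q`!%:R != 0 :> rat.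
Proof. by rewrite pnatr_eq0 -lt0n fact_gt0. Qed.

Lemma nat_coefs_divided_power n (a : {poly {mpoly rat[n]}}) :
    a`_0 = 0 ->
    (forall j, nat_coefs ((j`!%:R : rat) *: a`_j)) ->
  forall k m, nat_coefs ((m`!%:R / k`!%:R : rat) *: (a ^+ k)`_m).
Proof.
move=> a0 aP; elim=> [|k IHk] [|m].
- by move=> u; rewrite expr0 coef1 fact0 divr1 scale1r mcoeff1 natr_nat.
- by move=> u; rewrite expr0 coef1 scaler0 mcoeff0.
- by move=> u; rewrite exprS coef0M a0 mul0r scaler0 mcoeff0.
have Sq_neq0 q : q.+1%:R != 0 :> rat by rewrite pnatr_eq0.
have -> : (a ^+ k.+1)`_m.+1 = \sum_(j < m.+1)
    ((k.+1)%:R * (m - j).+1%:R / m.+1%:R : rat) *: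
      (a`_(m - j).+1 * (a ^+ k)`_j).
  have := congr1 (fun q : {poly _} => q`_m) (deriv_exp a k.+1).
  rewrite /= coef_deriv coefMn coefMr => E.
  apply: (scalerI (Sq_neq0 m)); rewrite scaler_nat E scaler_sumr -sumrMnl.
  apply: eq_bigr => j _; rewrite coef_deriv scalerA.
  rewrite [X in X *: _]mulrC divfK // -natrM scaler_nat.
  by rewrite mulrnAl -mulrnA mulnC.
rewrite scaler_sumr; apply: nat_coefs_sum => -[j /= lt_jm].
have -> : ((m.+1)`!%:R / (k.+1)`!%:R : rat) *:
    (((k.+1)%:R * (m - j).+1%:R / m.+1%:R : rat) *:
      (a`_(m - j).+1 * (a ^+ k)`_j)) =
  ('C(m, j)%:R *: ((j`!%:R / k`!%:R : rat) *: (a ^+ k)`_j)) *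
     ((((m - j).+1)`!%:R : rat) *: a`_(m - j).+1).
  rewrite -!scalerAl -!scalerAr !scalerA [a`__ * _]mulrC; congr (_ *: _).
  rewrite !factS -(@bin_fact m j lt_jm) !natrM.
  by field; rewrite !fact_rat_neq0 addrC natr1 Sq_neq0 addrC natr1 Sq_neq0.
apply: nat_coefsM (aP _) => u.
by rewrite mcoeffZ; apply: rpredM (IHk _ _); apply: natr_nat.
Qed.

Lemma beta_rat_nat n : nat_coefs (beta_rat n).
Proof.
rewrite /beta_rat scaler_sumr; apply: nat_coefs_sum => k.
rewrite scalerA; apply: nat_coefs_divided_power => [|j].
  by rewrite coef_sum big1 // => i _; rewrite coefZ coefXn mulr0.
rewrite coef_sum scaler_sumr; apply: nat_coefs_sum => i m.
rewrite coefZ coefXn; have [->|_] := eqVneq j i.+1; last first.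
  by rewrite mulr0 scaler0 mcoeff0.
by rewrite mulr1 scalerA divff ?fact_rat_neq0 // scale1r mcoeffX natr_nat.
Qed.

Lemma beta_intE n : map_mpoly intr (beta_int n) = beta_rat n.
Proof.
apply/mpolyP=> m; rewrite mcoeff_map_mpoly.
have -> : (beta_int n)@_m = numq (beta_rat n)@_m.
  rewrite /beta_int /map_mpoly /mmap raddf_sum /=.
  under eq_bigr => u _ do rewrite mmap1_id mcoeffCM mcoeffX.
  have [m_in|m_notin] := boolP (m \in msupp (beta_rat n)).
    rewrite (bigD1_seq m) ?msupp_uniq //= eqxx mulr1 big1 ?addr0 // => u.
    by move=> /negPf ->; rewrite mulr0.
  rewrite big_seq big1 => [|u u_in].
    by move: m_notin; rewrite -mcoeff_eq0 => /eqP ->.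
  have [eq_um|_] := eqVneq u m; last by rewrite mulr0.
  by rewrite -eq_um u_in in m_notin.
exact/numqK/intr_nat/beta_rat_nat.
Qed.

(* Main.v *)
(* A series is rational iff it is annihilated by P(S) for some nonzero
   polynomial P, where S is the shift of coefficients. For exponential
   generating series, the product is the shuffle product, S is the derivative,
   and B = exp_!(A) satisfies S B = (S A) B. In characteristic p every
   D = S^(p^k) is again a derivation, so S(B^-1 D B - D A) = 0, that is,
   D B = (D A + c_k) B for a constant c_k. Any nonzero P divides a nonzero
   L = \sum_k l_k X^(p^k), and then L(S) B = (L(S) A + c) B for a constant c:
   if L(S) A = 0 then L - c annihilates B, and if L(S) B = 0 then X L
   annihilates A. *)
Require Import Defs.
From HB Require Import structures.
From mathcomp Require Import all_boot all_order all_algebra.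
From mathcomp Require Import mpoly ring.
From mathcomp Require boolp.
Set Implicit Arguments.
Unset Strict Implicit.
Unset Printing Implicit Defensive.
Import GRing.Theory Num.Theory.
Local Open Scope ring_scope.

(** * The commutative ring of sequences under the shuffle product *)

Definition shuffle (R : comNzRingType) := nat -> R.

Section ShuffleRing.
Variable R : comNzRingType.
Implicit Types (X Y Z : shuffle R) (n : nat).

HB.instance Definition _ := boolp.gen_eqMixin (shuffle R).
HB.instance Definition _ := boolp.gen_choiceMixin (shuffle R).

Definition shift X : shuffle R := fun n => X n.+1.
Definition cst (c : R) : shuffle R := fun n => if n is 0%N then c else 0.
Definition shuffle_add X Y : shuffle R := fun n => X n + Y n.
Definition shuffle_opp X : shuffle R := fun n => - X n.

(* The shuffle product [\sum_i 'C(n, i) X_i Y_(n - i)], defined as the unique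
   bilinear product for which the shift is a derivation. *)
Fixpoint shuffle_mul X Y n : R :=
  if n is m.+1 then shuffle_mul (shift X) Y m + shuffle_mul X (shift Y) m
  else X 0%N * Y 0%N.

Fact shuffle_addA : associative shuffle_add.
Proof. by move=> X Y Z; apply/boolp.funext => n; apply: addrA. Qed.

Fact shuffle_addC : commutative shuffle_add.
Proof. by move=> X Y; apply/boolp.funext => n; apply: addrC. Qed.

Fact shuffle_add0 : left_id (cst 0) shuffle_add.
Proof. by move=> X; apply/boolp.funext => -[|n]; apply: add0r. Qed.

Fact shuffle_addN : left_inverse (cst 0) shuffle_opp shuffle_add.
Proof. by move=> X; apply/boolp.funext => -[|n]; apply: addNr. Qed.

HB.instance Definition _ := GRing.isZmodule.Build (shuffle R)
  shuffle_addA shuffle_addC shuffle_add0 shuffle_addN.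

Fact shuffle_mulDl : left_distributive shuffle_mul shuffle_add.
Proof.
move=> X Y Z; apply/boolp.funext => n; rewrite /shuffle_add.
elim: n => [|n IHn] /= in X Y Z *; first by rewrite mulrDl.
by rewrite !IHn addrACA.
Qed.

Fact shuffle_mulC : commutative shuffle_mul.
Proof.
move=> X Y; apply/boolp.funext => n; elim: n => [|n IHn] /= in X Y *.
  exact: mulrC.
by rewrite addrC !(IHn X) (IHn (shift X)).
Qed.

Lemma shift_mul X Y :
  shift (shuffle_mul X Y) =
  shuffle_add (shuffle_mul (shift X) Y) (shuffle_mul X (shift Y)).
Proof. by []. Qed.

(** The constant terms agree and, the shift being a derivation, the shifts of both sides expand into
    the same three triple products; induction on the index does the rest. *)
Fact shuffle_mulA : associative shuffle_mul.
Proof.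
have mulDr X Y Z : shuffle_mul X (shuffle_add Y Z) =
    shuffle_add (shuffle_mul X Y) (shuffle_mul X Z).
  by rewrite shuffle_mulC shuffle_mulDl !(shuffle_mulC X).
move=> X Y Z; apply/boolp.funext => n; elim: n => [|n IHn] in X Y Z *.
  exact: mulrA.
rewrite [LHS]/= [RHS]/= !shift_mul mulDr shuffle_mulDl /shuffle_add !IHn.
exact: addrA.
Qed.

Fact shuffle_mul0 X : shuffle_mul (cst 0) X = cst 0.
Proof.
apply: (@addrI (shuffle R) (shuffle_mul (cst 0) X)).
by rewrite addr0 -[LHS]shuffle_mulDl shuffle_add0.
Qed.

Lemma cst_mul c X n : shuffle_mul (cst c) X n = c * X n.
Proof.
elim: n => [|n IHn] //= in X *.
have -> : shift (cst c) = cst 0 by apply/boolp.funext => -[].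
by rewrite shuffle_mul0 IHn /cst; case: (n) => [|m]; rewrite add0r.
Qed.

Fact shuffle_mul1 : left_id (cst 1) shuffle_mul.
Proof. by move=> X; apply/boolp.funext => n; rewrite cst_mul mul1r. Qed.

Fact shuffle_1neq0 : cst 1 != 0.
Proof.
by apply/eqP => /(congr1 (@^~ 0%N)) /= /eqP; rewrite (negPf (oner_neq0 R)).
Qed.

HB.instance Definition _ := GRing.Zmodule_isComNzRing.Build (shuffle R)
  shuffle_mulA shuffle_mulC shuffle_mul1 shuffle_mulDl shuffle_1neq0.

Fact shift_is_zmod_morphism : zmod_morphism shift.
Proof. by []. Qed.
HB.instance Definition _ :=
  GRing.isZmodMorphism.Build (shuffle R) (shuffle R) shift
    shift_is_zmod_morphism.

Fact cst_is_zmod_morphism : zmod_morphism cst.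
Proof.
move=> a b; apply/boolp.funext => -[|n] //.
by rewrite [LHS]/= -[RHS]/(0 - 0) subr0.
Qed.
HB.instance Definition _ :=
  GRing.isZmodMorphism.Build R (shuffle R) cst cst_is_zmod_morphism.

Fact cst_is_monoid_morphism : monoid_morphism cst.
Proof.
split=> // a b; apply/boolp.funext => n; rewrite [RHS]cst_mul.
by case: n => //= n; rewrite mulr0.
Qed.
HB.instance Definition _ :=
  GRing.isMonoidMorphism.Build R (shuffle R) cst cst_is_monoid_morphism.

Lemma coef_shuffle0 n : (0 : shuffle R) n = 0.
Proof. by case: n. Qed.

Lemma coef_shuffle_sum I (r : seq I) (F : I -> shuffle R) n :
  (\sum_(i <- r) F i) n = \sum_(i <- r) F i n.
Proof.
by elim/big_rec2: _ => [|i _ X _ <-//]; apply: coef_shuffle0.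
Qed.

Lemma coef_cstM c X n : (cst c * X) n = c * X n.
Proof. exact: cst_mul. Qed.

Lemma coef0_shuffleM X Y : (X * Y) 0%N = X 0%N * Y 0%N.
Proof. by []. Qed.

Lemma coefS_shuffleM X Y n :
  (X * Y) n.+1 = (shift X * Y) n + (X * shift Y) n.
Proof. by []. Qed.

Lemma shiftM X Y : shift (X * Y) = shift X * Y + X * shift Y.
Proof. by []. Qed.

Lemma shift_cst c : shift (cst c) = 0.
Proof. by apply/boolp.funext => -[]. Qed.

Lemma shift_eq0 X : shift X = 0 -> X = cst (X 0%N).
Proof.
move=> X'0; apply/boolp.funext => -[//|n].
by rewrite -[X n.+1]/(shift X n) X'0 coef_shuffle0.
Qed.

Lemma coef_iter_shift n X m : iter n shift X m = X (n + m)%N.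
Proof. by elim: n m => [|n IHn] m //=; rewrite /shift IHn addnS. Qed.

(** * The exponential as a limit of Picard iterates *)

Definition agree N X Y := forall i, (i < N)%N -> X i = Y i.

Lemma agree_mul N X X' Y Y' :
  agree N X X' -> agree N Y Y' -> agree N (X * Y) (X' * Y').
Proof.
move=> XX' YY' n; elim: n => [|n IHn] in N X X' Y Y' XX' YY' * => ltnN.
  by rewrite !coef0_shuffleM XX' ?YY'.
case: N => // N in XX' YY' ltnN *.
have shiftP U V : agree N.+1 U V -> agree N (shift U) (shift V).
  by move=> UV i ltiN; apply: UV.
have weak U V : agree N.+1 U V -> agree N U V.
  by move=> UV i ltiN; apply/UV/leqW.
by rewrite !coefS_shuffleM; congr (_ + _); apply: (IHn N); auto.
Qed.

(* The equation [y' = a' y], [y(0) = 1] satisfied by [y = exp a], as a fixed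
   point equation on coefficients with respect to [x ^ n / n!]. *)
Definition picard X Y : shuffle R :=
  fun n => if n is m.+1 then (shift X * Y) m else 1.

(** Integration gains one coefficient: [picard X] is a contraction for the adic distance. *)
Lemma agree_picard N X X' Y Y' :
  agree N.+1 X X' -> agree N Y Y' -> agree N.+1 (picard X Y) (picard X' Y').
Proof.
move=> XX' YY' [//|n] ltnN /=; apply: (agree_mul (N := N)) => // i ltiN.
exact: XX'.
Qed.

Lemma agree_iter_picard N X X' Y Y' :
  agree N X X' -> agree N (iter N (picard X) Y) (iter N (picard X') Y').
Proof.
elim: N => [_ []//|N IHN] XX' /=; apply: agree_picard => //.
by apply: IHN => i ltiN; apply/XX'/leqW.
Qed.

(** Coefficient [n] is stable from iterate [n.+1] on, so this diagonal is the limit of the iterates.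
    No division by factorials occurs, hence any [R] is allowed. *)
Definition shuffle_exp X : shuffle R := fun n => iter n.+1 (picard X) 0 n.

Lemma agree_shuffle_exp N X X' :
  agree N X X' -> agree N (shuffle_exp X) (shuffle_exp X').
Proof.
move=> XX' n ltnN; apply: (agree_iter_picard (N := n.+1)) => // i ltin.
by apply: XX'; apply: leq_trans ltnN.
Qed.

Lemma shuffle_exp_iter X N Y :
  agree N (shuffle_exp X) (iter N (picard X) Y).
Proof.
(* The last [n.+1] iterations alone determine coefficient [n], whatever they start from. *)
move=> n ltnN; rewrite -(subnK ltnN) addnC iterD.
exact: (agree_iter_picard (N := n.+1)).
Qed.

Lemma shuffle_exp0 X : shuffle_exp X 0%N = 1.
Proof. by []. Qed.

Lemma shift_shuffle_exp X : shift (shuffle_exp X) = shift X * shuffle_exp X.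
Proof.
apply/boolp.funext => n.
rewrite -[RHS]/(picard X (shuffle_exp X) n.+1) -[LHS]/(shuffle_exp X n.+1).
rewrite (shuffle_exp_iter (N := n.+2) X 0) // iterS.
have /agree_picard : agree n.+2 X X by [].
apply=> // i ltin; symmetry; exact: shuffle_exp_iter.
Qed.

(** The product has zero derivative, so it equals its constant term. This provides the inverse of an
    exponential in every characteristic. *)
Lemma shuffle_expN X : shuffle_exp (- X) * shuffle_exp X = 1.
Proof.
have /shift_eq0-> : shift (shuffle_exp (- X) * shuffle_exp X) = 0.
  by rewrite shiftM !shift_shuffle_exp raddfN; ring.
by rewrite coef0_shuffleM !shuffle_exp0 mulr1.
Qed.

End ShuffleRing.

Definition shuffle_map (R R' : comNzRingType) (f : R -> R') (X : shuffle R) :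
  shuffle R' := fun n => f (X n).

(** Only ring operations enter [picard]. Used both to embed integral polynomials into rational ones
    and to evaluate them in a field. *)
Lemma shuffle_exp_map (R R' : comNzRingType) (f : {rmorphism R -> R'})
    (X : shuffle R) n :
  f (shuffle_exp X n) = shuffle_exp (shuffle_map f X) n.
Proof.
have fM (Y Z : shuffle R) m :
    f ((Y * Z) m) = (shuffle_map f Y * shuffle_map f Z) m.
  elim: m => [|m IHm] in Y Z *; first by rewrite !coef0_shuffleM rmorphM.
  by rewrite !coefS_shuffleM rmorphD !IHm.
suff fP N m : f (iter N (picard X) 0 m) =
    iter N (picard (shuffle_map f X)) 0 m by exact: fP.
elim: N m => [|N IHN] m.
  by rewrite /= !coef_shuffle0 rmorph0.
case: m => [|m] /=; first by rewrite rmorph1.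
rewrite fM; congr ((_ * _ : shuffle R') m); apply/boolp.funext => i.
exact: IHN.
Qed.

(** * Comparison of [exp_bang] with the Picard exponential *)

Section ExpBang.
Variable R : comNzRingType.
Implicit Types p q : {poly R}.

(* Reads [p] as an exponential generating series. *)
Definition egs p : shuffle R := fun n => p`_n *+ n`!.

Lemma shift_egs p : shift (egs p) = egs p^`().
Proof.
apply/boolp.funext => n.
by rewrite /egs /shift coef_deriv -mulrnA -factS.
Qed.

Lemma egsM p q : egs (p * q) = egs p * egs q.
Proof.
apply/boolp.funext => n; elim: n => [|n IHn] in p q *.
  by rewrite coef0_shuffleM /egs !fact0 !mulr1n coef0M.
rewrite coefS_shuffleM !shift_egs -!IHn.
by rewrite -[LHS]/(shift (egs _) n) shift_egs derivM /egs coefD mulrnDl.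
Qed.

End ExpBang.

Lemma egs_exp_trunc n (a : {poly {mpoly rat[n]}}) N : a`_0 = 0 ->
  egs (\sum_(k < N) (k`!%:R^-1 : rat)%:MP%:P * a ^+ k) =
  iter N (picard (egs a)) 0.
Proof.
move=> a0; elim: N => [|N IHN].
  rewrite big_ord0; apply/boolp.funext => i.
  by rewrite /egs coef0 mul0rn /= coef_shuffle0.
rewrite iterS -IHN; apply/boolp.funext => -[|m].
  rewrite /egs /= big_ord_recl fact0 invr1 mpolyC1 mulr1n expr0 mulr1.
  rewrite coefD coef1 /=.
  rewrite coef_sum big1 ?addr0 // => i _.
  by rewrite coefCM exprS coef0M a0 mul0r mulr0.
rewrite -[LHS]/(shift (egs _) m) -[RHS]/((shift _ * _) m) !shift_egs -egsM.
congr (egs _ m); rewrite raddf_sum /=.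
under eq_bigr => k _ do rewrite derivM derivC mul0r add0r deriv_exp.
rewrite big_ord_recl mulr0n mulr0 add0r mulr_sumr; apply: eq_bigr => i _.
rewrite lift0 mulrnAr -mulrnAl mulrCA.
congr (_ * (_ * _)); rewrite -!rmorphMn -[_ *+ i.+1]mulr_natl.
have i1_neq0 : i.+1%:R != 0 :> rat by rewrite pnatr_eq0.
by rewrite factS natrM invfM mulVKf.
Qed.

Lemma beta_rat_shuffle_exp n :
  beta_rat n = shuffle_exp (egs (generic_egs n)) n.
Proof.
have a0 : (generic_egs n)`_0 = 0.
  by rewrite coef_sum big1 // => i _; rewrite coefZ coefXn mulr0.
rewrite /shuffle_exp -egs_exp_trunc // /egs coef_sum -[RHS]mulr_natl.
rewrite -(rmorph_nat (@mpolyC n rat)) mul_mpolyC; congr (_ *: _).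
by apply: eq_bigr => i _; rewrite coefCM mul_mpolyC.
Qed.

(** Indices are shifted by one since ['X_i] stands for the coefficient of index [i.+1]; the constant
    term and the terms beyond [n] are 0. *)
Definition truncated_seq (R : comNzRingType) n (h : 'I_n -> R) : shuffle R :=
  fun i => if i is j.+1 then oapp h 0 (insub j) else 0.

(** It suffices to compare the images over the rationals, where the factorials of [egs] cancel the
    denominators of [generic_egs]. *)
Lemma beta_int_shuffle_exp n :
  beta_int n = shuffle_exp (truncated_seq (fun i => 'X_i)) n.
Proof.
pose f : {rmorphism {mpoly int[n]} -> {mpoly rat[n]}} := map_mpoly intr.
have f_inj : injective f.
  move=> P Q /mpolyP PQ; apply/mpolyP => m; have := PQ m.
  by rewrite !mcoeff_map_mpoly => /intr_inj.
apply: f_inj; rewrite [LHS]beta_intE beta_rat_shuffle_exp (shuffle_exp_map f).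
congr (shuffle_exp _ n); apply/boolp.funext => -[|i].
  rewrite /egs /shuffle_map rmorph0 mulr1n coef_sum big1 // => j _.
  by rewrite coefZ coefXn mulr0.
rewrite /egs coef_sum /shuffle_map /truncated_seq.
case: insubP => [j ltjn <-|geni] /=.
  rewrite (bigD1 j) //= coefZ coefXn eqxx mulr1 big1 ?addr0 => [|k nekj].
    rewrite -scaler_nat scalerA divff ?fact_rat_neq0 // scale1r.
    by rewrite /f /map_mpoly mmapX mmap1U.
  by rewrite coefZ coefXn eqSS eq_sym (inj_eq val_inj) (negPf nekj) mulr0.
rewrite rmorph0 big1 ?mul0rn // => j _; rewrite coefZ coefXn eqSS.
case: eqP => [eij|_]; last by rewrite mulr0.
by rewrite eij ltn_ord in geni.
Qed.

(** Evaluation commutes with [shuffle_exp], and coefficient [n] is not affected by the truncation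
    beyond [n]. *)
Lemma exp_bangE (K : fieldType) (A : fps K) (A0 : A 0%N = 0) :
  exp_bang A = shuffle_exp A.
Proof.
apply/boolp.funext => n; rewrite /exp_bang beta_int_shuffle_exp shuffle_exp_map.
apply: (agree_shuffle_exp (N := n.+1)) => // -[|i] ltin.
  by rewrite /shuffle_map rmorph0 A0.
by rewrite /shuffle_map /truncated_seq insubT //= mmapX mmap1U.
Qed.

(** * Iterated derivations in characteristic [p] *)

Section Leibniz.
Variables (R : comNzRingType) (D : R -> R).
Hypothesis DD : {morph D : x y / x + y}.
Hypothesis DM : forall x y, D (x * y) = D x * y + x * D y.

Lemma iter_derivation n x y :
  iter n D (x * y) =
  \sum_(i < n.+1) (iter i D x * iter (n - i) D y) *+ 'C(n, i).
Proof.
have D0 : D 0 = 0 by apply: (@addrI R (D 0)); rewrite -DD !addr0.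
have DMn z k : D (z *+ k) = D z *+ k.
  by elim: k => [|k IHk]; rewrite ?mulr0n // !mulrS DD IHk.
elim: n => [|n IHn]; first by rewrite big_ord1 subnn bin0.
rewrite iterS IHn (big_morph D DD D0).
under eq_bigr do rewrite DMn DM mulrnDl.
rewrite big_split [in RHS]big_ord_recl.
(* Pascal's rule splits each term after the first in two. *)
rewrite [X in _ = _ + X](eq_bigr (fun i : 'I_n.+1 =>
  (iter i.+1 D x * iter (n - i) D y) *+ 'C(n, i.+1) +
  (iter i.+1 D x * iter (n - i) D y) *+ 'C(n, i))); last first.
  by move=> i _; rewrite lift0 subSS -mulrnDr binS.
rewrite big_split addrA addrC; congr (_ + _).
rewrite big_ord_recl [in RHS]big_ord_recr /= (@bin_small n n.+1) // mulr0n.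
rewrite addr0 !subn0 !bin0.
congr (_ + _); apply: eq_bigr => i _.
by rewrite -[D (iter (n - _) D y)]iterS /bump leq0n add1n subnSK.
Qed.

(** In the Leibniz formula, [p] divides every binomial coefficient except the two extreme ones. *)
Lemma iter_prime_derivation p x y : p \in [pchar R] ->
  iter p D (x * y) = iter p D x * y + x * iter p D y.
Proof.
move=> charRp; have p_pr := pcharf_prime charRp; have := iter_derivation p x y.
case: p p_pr charRp => // p p_pr charRp ->.
rewrite big_ord_recl big_ord_recr /= big1 => [|i _]; last first.
  have /dvdnP[k ->] : (p.+1 %| 'C(p.+1, lift ord0 (widen_ord (leqnSn p) i)))%N.
    by apply: prime_dvd_bin => //; rewrite lift0 /= ltnS ltn_ord.
  by rewrite mulrnA -mulr_natr pcharf0 // mulr0.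
by rewrite bin0 subnn binn add0r addrC.
Qed.

End Leibniz.

Lemma iter_add (V : nmodType) (D : V -> V) (DD : {morph D : x y / x + y}) n :
  {morph iter n D : x y / x + y}.
Proof. by move=> x y; elim: n => //= n ->. Qed.

(** Induction on [k]: the prime case is applied to the derivation [iter (p ^ k) D]. *)
Lemma iter_pexp_derivation (R : comNzRingType) (D : R -> R) p k x y :
    {morph D : x y / x + y} ->
    (forall x y, D (x * y) = D x * y + x * D y) -> p \in [pchar R] ->
  iter (p ^ k) D (x * y) = iter (p ^ k) D x * y + x * iter (p ^ k) D y.
Proof.
move=> DD DM charRp; elim: k => [|k IHk] in x y *; first exact: DM.
rewrite expnS !iterM iter_prime_derivation //; exact: iter_add.
Qed.

(** * Linear recurrences and rationality *)

Section Recurrence.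
Variable K : fieldType.
Implicit Types (P Q : {poly K}) (X : shuffle K).

(** This is [P] evaluated at the shift operator; [act P X = 0] is a linear recurrence with constant
    coefficients for [X]. *)
Definition act P X : shuffle K :=
  \sum_(i < size P) cst P`_i * iter i (@shift K) X.

Lemma act_wide N P X : (size P <= N)%N ->
  act P X = \sum_(i < N) cst P`_i * iter i (@shift K) X.
Proof.
move=> leN; rewrite /act.
rewrite (big_ord_widen N (fun i => cst P`_i * iter i (@shift K) X) leN).
rewrite big_mkcond; apply: eq_bigr => i _; case: ltnP => // lei.
by rewrite nth_default // rmorph0 mul0r.
Qed.

Lemma coef_act N P X n : (size P <= N)%N ->
  act P X n = \sum_(i < N) P`_i * X (n + i)%N.
Proof.
move=> leN; rewrite (act_wide _ leN) coef_shuffle_sum; apply: eq_bigr => i _.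
by rewrite coef_cstM coef_iter_shift addnC.
Qed.

Lemma actD P Q X : act (P + Q) X = act P X + act Q X.
Proof.
have [leP leQ] := (leq_maxl (size P) (size Q), leq_maxr (size P) (size Q)).
rewrite (act_wide _ (size_polyD P Q)) (act_wide _ leP) (act_wide _ leQ).
by rewrite -big_split; apply: eq_bigr => i _; rewrite coefD rmorphD mulrDl.
Qed.

Lemma act_sum I (r : seq I) (F : I -> {poly K}) X :
  act (\sum_(i <- r) F i) X = \sum_(i <- r) act (F i) X.
Proof.
apply: (big_morph (act^~ X)) => [P Q|]; first exact: actD.
by rewrite /act size_poly0 big_ord0.
Qed.

Lemma actZXn c n X : act (c *: 'X^n) X = cst c * iter n (@shift K) X.
Proof.
have le_n : (size (c *: 'X^n) <= n.+1)%N.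
  by rewrite (leq_trans (size_scale_leq _ _)) // size_polyXn.
rewrite (act_wide _ le_n) big_ord_recr big1 /= => [|i _].
  by rewrite add0r coefZ coefXn eqxx mulr1.
by rewrite coefZ coefXn ltn_eqF // mulr0 rmorph0 mul0r.
Qed.

Lemma actC c X : act c%:P X = cst c * X.
Proof. by rewrite -alg_polyC -(expr0 'X) actZXn. Qed.

Lemma actMX P X : act (P * 'X) X = shift (act P X).
Proof.
apply/boolp.funext => n; rewrite /shift (coef_act _ _ (size_polyMleq _ _)).
rewrite size_polyX addn2 /= big_ord_recl coefMX mul0r add0r.
rewrite (coef_act _ _ (leqnn _)); apply: eq_bigr => i _.
by rewrite coefMX lift0 addnS.
Qed.

Lemma act_cst_mul P c X : act P (cst c * X) = cst c * act P X.
Proof.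
apply/boolp.funext => n; rewrite coef_cstM !(coef_act _ _ (leqnn _)) mulr_sumr.
by apply: eq_bigr => i _; rewrite coef_cstM mulrCA.
Qed.

Lemma act0r P : act P 0 = 0.
Proof.
by rewrite -(mul0r 0) -(rmorph0 (@cst K)) act_cst_mul rmorph0 !mul0r.
Qed.

Lemma actZ c P X : act (c *: P) X = cst c * act P X.
Proof.
rewrite (act_wide _ (size_scale_leq c P)) /act mulr_sumr.
by apply: eq_bigr => i _; rewrite coefZ rmorphM mulrA.
Qed.

Lemma actM P Q X : act (P * Q) X = act P (act Q X).
Proof.
elim/poly_ind: P => [|P c IHP]; first by rewrite mul0r !actC !rmorph0 !mul0r.
by rewrite mulrDl !actD mulrAC !actMX IHP mul_polyC actZ actC.
Qed.

(** From degree [N] on, convolution with [g] is the recurrence operator of the reversed polynomial: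
    the first [n] terms of the convolution involve coefficients of [g] of index above [N], which are
    0. *)
Lemma coef_fps_mul_rev N (A : fps K) (g : {poly K}) n : (size g <= N.+1)%N ->
  fps_mul A (fps_of_poly g) (n + N)%N =
  act (\poly_(i < N.+1) g`_(N - i)) A n.
Proof.
move=> leN; rewrite (coef_act _ _ (size_poly _ _)) /fps_mul -addnS.
rewrite big_split_ord /= big1 ?add0r => [|i _].
  apply: eq_bigr => i _; rewrite coef_poly ltn_ord /fps_of_poly mulrC.
  by rewrite subnDl.
rewrite /fps_of_poly nth_default ?mulr0 // (leq_trans leN) //.
rewrite -addnBAC ?[(i <= n)%N]ltnW // addnC -[N.+1]addn1 leq_add2l.
by rewrite subn_gt0 ltn_ord.
Qed.

Lemma rational_fpsP (A : fps K) :
  rational_fps A <-> exists2 P : {poly K}, P != 0 & act P A = 0.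
Proof.
split=> [[f [g [g0 Ag]]]|[P nzP PA]].
  (* This [N] is large enough both to reverse [g] and to make the coefficients of [f] vanish from
     degree [N] on. *)
  pose N := (size f + size g)%N; exists (\poly_(i < N.+1) g`_(N - i)).
    apply: contraNneq g0 => /(congr1 (fun q : {poly K} => q`_N)).
    by rewrite coef_poly ltnSn subnn coef0 horner_coef0 => ->.
  apply/boolp.funext => n; rewrite -coef_fps_mul_rev; last first.
    by rewrite leqW // leq_addl.
  rewrite Ag coef_shuffle0 /fps_of_poly nth_default //.
  by rewrite addnCA leq_addr.
have [d sizeP] : {d | size P = d.+1}.
  by exists (size P).-1; rewrite prednK // size_poly_gt0.
(* Reversing at the exact degree [d] turns the leading coefficient of [P] into [g.[0]]; the product
   then vanishes from degree [d] on. *)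
pose g := \poly_(i < d.+1) P`_(d - i).
exists (\poly_(n < d) fps_mul A (fps_of_poly g) n), g; split.
  move: nzP; rewrite -lead_coef_eq0 lead_coefE sizeP.
  by rewrite horner_coef0 coef_poly subn0.
move=> n; rewrite [RHS]coef_poly; case: ltnP => // le_dn.
rewrite -(subnK le_dn) coef_fps_mul_rev ?size_poly //.
suff -> : \poly_(i < d.+1) g`_(d - i) = P by rewrite PA coef_shuffle0.
apply/polyP => i; rewrite coef_poly; case: ltnP => [le_id|le_di].
  by rewrite coef_poly ltnS leq_subr subKn.
by rewrite nth_default // sizeP.
Qed.

(** The quotient by [P] has dimension [n.-1] for [n = size P], so the residues of the [n] powers
    ['X^(p ^ k)] are linearly dependent; [v] is such a relation. *)
Lemma dvdp_p_polynomial p P : (1 < p)%N -> P != 0 ->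
  exists (n : nat) (v : 'rV[K]_n),
    v != 0 /\ P %| \sum_(k < n) v 0 k *: 'X^(p ^ k).
Proof.
move=> p_gt1 nzP; set n := size P.
pose M : 'M[K]_(n, n.-1) := \matrix_k poly_rV ('X^(p ^ k) %% P).
have /rowV0Pn[v /sub_kermxP vM nz_v] : kermx M != 0.
  rewrite kermx_eq0 /row_free neq_ltn (leq_ltn_trans (rank_leq_col M)) //.
  by rewrite prednK // size_poly_gt0.
exists n, v; split=> //; rewrite /dvdp.
have -> : (\sum_(k < n) v 0 k *: 'X^(p ^ k)) %% P = rVpoly (v *m M).
  rewrite mulmx_sum_row raddf_sum
    (big_morph (fun q : {poly K} => q %% P) (modpD P) (mod0p P)).
  apply: eq_bigr => k _; rewrite modpZl rowK /= linearZ /= poly_rV_K //.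
  by rewrite -ltnS prednK ?size_poly_gt0 // ltn_modp.
by rewrite vM raddf0.
Qed.

(** The exponents [p ^ j] are distinct, so a nonzero [v] gives a nonzero polynomial. *)
Lemma coef_p_polynomial p n (v : 'rV[K]_n) (k : 'I_n) : (1 < p)%N ->
  (\sum_(j < n) v 0 j *: 'X^(p ^ j))`_(p ^ k) = v 0 k.
Proof.
move=> p_gt1; rewrite coef_sum (bigD1 k) //= coefZ coefXn eqxx mulr1.
rewrite big1 ?addr0 // => j nekj; rewrite coefZ coefXn eqn_exp2l //.
by rewrite (inj_eq val_inj) eq_sym (negPf nekj) mulr0.
Qed.

End Recurrence.

(** * Exponentials and rationality in characteristic [p] *)

Lemma pchar_shuffle (R : comNzRingType) p :
  p \in [pchar R] -> p \in [pchar shuffle R].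
Proof.
case/andP=> p_pr /eqP p0; rewrite inE p_pr -(rmorph_nat (@cst R)) p0.
by rewrite rmorph0 /=.
Qed.

Lemma iter_shift_shuffle_exp (R : comNzRingType) p (A : shuffle R) k :
    p \in [pchar R] ->
  exists c, iter (p ^ k) (@shift R) (shuffle_exp A) =
            (iter (p ^ k) (@shift R) A + cst c) * shuffle_exp A.
Proof.
move=> charRp; set q := (p ^ k)%N; set S := @shift R.
set B := shuffle_exp A; set B' := shuffle_exp (- A).
have B'B : B' * B = 1 := shuffle_expN A.
have SB : S B = S A * B := shift_shuffle_exp A.
have SB' : S B' = - S A * B' by rewrite [LHS]shift_shuffle_exp raddfN.
have SqM X Y : iter q S (X * Y) = iter q S X * Y + X * iter q S Y.
  by apply: iter_pexp_derivation (pchar_shuffle charRp).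
pose U := B' * iter q S B - iter q S A.
have /shift_eq0 defU : S U = 0.
  have -> : S U = S B' * iter q S B + B' * iter q.+1 S B - iter q.+1 S A by [].
  (* Moving the extra shift innermost allows [S B = S A * B] to be used before the Leibniz rule for
     [iter q S]; the two terms containing the factor [S A] then cancel. *)
  rewrite !iterSr SB SB' SqM.
  transitivity ((B' * B - 1) * iter q S (S A)); first by rewrite /=; ring.
  by rewrite B'B subrr mul0r.
by exists (U 0%N); rewrite -defU /U addrC subrK mulrAC B'B mul1r.
Qed.

Lemma rational_shuffle_exp (K : fieldType) p (A : fps K) : p \in [pchar K] ->
  rational_fps A <-> rational_fps (shuffle_exp A).
Proof.
move=> charKp; have p_gt1 := prime_gt1 (pcharf_prime charKp).
have actB n (v : 'rV[K]_n) (L := \sum_(k < n) v 0 k *: 'X^(p ^ k)) :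
    exists c, act L (shuffle_exp A) = (act L A + cst c) * shuffle_exp A.
  have [c cP] := boolp.choice (fun k => iter_shift_shuffle_exp A k charKp).
  exists (\sum_(k < n) v 0 k * c k); rewrite !act_sum rmorph_sum -big_split.
  rewrite mulr_suml; apply: eq_bigr => k _; rewrite !actZXn cP rmorphM.
  by rewrite mulrA mulrDr.
split=> /rational_fpsP[P nzP PA]; apply/rational_fpsP;
  have [n [v [nz_v /dvdpP[Q defL]]]] := dvdp_p_polynomial p_gt1 nzP;
  have [c] := actB n v; set L := \sum_(k < n) _ in defL *;
  have [k nz_vk] : exists k, v 0 k != 0.
- by case/rV0Pn: nz_v => k; exists k.
- rewrite [in RHS]defL actM PA act0r add0r => LB; exists (L - c%:P).
    (* Subtracting a constant leaves the coefficient [v 0 k] of positive degree [p ^ k]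
       unchanged. *)
    apply: contraNneq nz_vk => /(congr1 (fun q : {poly K} => q`_(p ^ k))).
    rewrite coefB coef_p_polynomial // coefC expn_eq0 gtn_eqF ?(ltnW p_gt1) //.
    by rewrite subr0 coef0 => ->.
  by rewrite -polyCN actD LB actC rmorphN mulNr subrr.
- by case/rV0Pn: nz_v => k; exists k.
rewrite [in LHS]defL actM PA act0r => LB; exists (L * 'X).
  rewrite mulf_eq0 polyX_eq0 orbF; apply: contraNneq nz_vk => L0.
  by rewrite -(coef_p_polynomial v k p_gt1) -/L L0 coef0.
(* Since the exponential is invertible, [LB] forces [act L A] to be a constant, which the additional
   factor ['X] kills. *)
rewrite actMX; suff -> : act L A = cst (- c) by rewrite shift_cst.
apply/eqP; rewrite rmorphN -addr_eq0 -[_ + _]mulr1 -(shuffle_expN A) mulrCA -LB.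
by rewrite mulr0.
Qed.

Theorem theorem1p1 (p : nat) (p_pr : prime p)
    (Fbar : closedFieldType) (iota : {rmorphism 'F_p -> Fbar})
    (Fbar_alg : integralRange iota)
    (K : fieldType) (incl : {rmorphism K -> Fbar})
    (A : fps K) (A0 : A 0%N = 0) :
  rational_fps A <-> rational_fps (exp_bang A).
Proof.
(* Field morphisms preserve the characteristic, which passes from ['F_p] to [Fbar] and then to
   [K]. *)
have charKp : p \in [pchar K].
  by rewrite -(fmorph_pchar incl) (fmorph_pchar iota) pchar_Fp.
by rewrite exp_bangE //; apply: rational_shuffle_exp charKp.
Qed.
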